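(* The only positive integers $n$ for which $\mathrm{pre}_2(n)=1$ are $n=1,2,$ and $4$.
   Context: A partition $\lambda=(\lambda_1,\dots,\lambda_\ell)$ of $n$ is a nonincreasing sequence of positive integers summing to $n$; $\ell$ is its length. For a partition $\lambda$ of length $\ell\ge 2$, $\mathrm{pre}_2(\lambda)$ is the partition whose parts (with multiplicity) are the products $\lambda_i\lambda_j$ over all $1\le i<j\le \ell$, sorted in nonincreasing order. For a positive integer $n$, $\mathrm{pre}_2(n)$ denotes the number of partitions $\nu$ of $n$ that lie in the image of $\mathrm{pre}_2$, i.e. such that $\nu=\mathrm{pre}_2(\lambda)$ for some partition $\lambda$ (of any size) of length at least $2$. *)

(* Defs.v *)
From mathcomp Require Import all_boot finmap.
From mathcomp Require Import boolp classical_sets functions cardinality.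

Set Implicit Arguments.
Unset Strict Implicit.
Unset Printing Implicit Defensive.

Local Open Scope classical_set_scope.
Local Open Scope nat_scope.

Definition is_partition (la : seq nat) : bool := sorted geq la && (0 \notin la).

Definition is_partition_of (n : nat) (la : seq nat) : bool :=
  is_partition la && (sumn la == n).

(* Indices are 0-based: the pairs enumerated are i < j < size la. *)
Definition pre2 (la : seq nat) : seq nat :=
  sort geq [seq nth 0 la i * nth 0 la j | j <- iota 0 (size la), i <- iota 0 j].

Definition pre2_image : set (seq nat) :=
  [set nu | exists la : seq nat,
     [/\ is_partition la, 2 <= size la & nu = pre2 la]].

Definition pre2_partitions (n : nat) : set (seq nat) :=
  [set nu | is_partition_of n nu /\ pre2_image nu].

Lemma size_partition (la : seq nat) : 0 \notin la -> size la <= sumn la.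
Proof.
elim: la => //= x la IH; rewrite inE negb_or eq_sym -lt0n => /andP[x0 /IH h].
by rewrite -add1n leq_add.
Qed.

Lemma mem_leq_sumn (la : seq nat) (x : nat) : x \in la -> x <= sumn la.
Proof.
elim: la => //= y la IH; rewrite inE => /orP[/eqP-> | /IH h].
  exact: leq_addr.
exact: leq_trans h (leq_addl _ _).
Qed.

(* [fset_set] below returns a junk value on infinite sets; this rules it out. *)
Lemma finite_pre2_partitions (n : nat) : finite_set (pre2_partitions n).
Proof.
pose f (t : n.-bseq 'I_n.+1) : seq nat := [seq val i | i <- t].
apply: (@sub_finite_set _ _ (f @` setT)); last exact: finite_image.
move=> nu [/andP[/andP[_ nu0] /eqP sum_nu] _].
have sz : size [seq (inord x : 'I_n.+1) | x <- nu] <= n.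
  by rewrite size_map -[n in _ <= n]sum_nu size_partition.
exists (Bseq sz) => //; rewrite /f /= -map_comp -[RHS]map_id.
apply/eq_in_map => x /mem_leq_sumn; rewrite sum_nu => le_x.
by rewrite /= inordK.
Qed.

Definition num_pre2 (n : nat) : nat := #|` fset_set (pre2_partitions n)|%fset.

(* Main.v *)
Require Import Defs.
From mathcomp Require Import all_boot.
From mathcomp Require Import finmap.
From mathcomp Require Import boolp cardinality.
From mathcomp Require Import zify.

(** The one-part partition [:: n] is always counted, since it is the image of
    [:: n; 1].  So the count is 1 exactly when no partition of length at least
    3 has second elementary symmetric function equal to n: a preimage of length
    l gives l(l-1)/2 products, and this number is 1 only for l = 2.

    Three families of preimages and one exceptional partition reach every n
    except 1, 2 and 4 ([exists_long_preimage]):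
    - (k, 1, 1) gives 2k + 1, hence every odd n >= 3;
    - (k, 2, 2) gives 4k + 4, hence every multiple of 4 from 8 on;
    - (k, 1, 1, 1, 1) gives 4k + 6, hence every n = 2 mod 4 from 10 on;
    - (1, 1, 1, 1) gives 6.

    Conversely, for n <= 4 a preimage has length at most 3, because length 4
    already yields six positive products.  For three parts a >= b >= c >= 1, the
    sum ab + ac + bc is 2a + 1, odd and at least 3, if b = 1, and it is more than
    ab >= 4 if b >= 2; so it is never 1, 2 or 4 ([pre2_partitions_singleton]). *)

Set Implicit Arguments.
Unset Strict Implicit.
Unset Printing Implicit Defensive.

Local Open Scope nat_scope.

Lemma size_pre2 (la : seq nat) : size (pre2 la) = 'C(size la, 2).
Proof.
rewrite size_sort size_allpairs_dep -bin2_sum -sumnE /index_iota subn0.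
by congr sumn; rewrite -[RHS]map_id; apply: eq_map => j; rewrite size_iota.
Qed.

Lemma sumn_pre2 (la : seq nat) :
  sumn (pre2 la) =
  sumn [seq nth 0 la i * nth 0 la j | j <- iota 0 (size la), i <- iota 0 j].
Proof. by apply: perm_sumn; rewrite perm_sort. Qed.

Lemma is_partition_pre2 (la : seq nat) :
  is_partition la -> is_partition (pre2 la).
Proof.
move=> /andP[_ la0]; apply/andP; split.
  by apply: sort_sorted => x y; apply: leq_total.
have pos i : i < size la -> nth 0 la i != 0.
  by move=> /(mem_nth 0) la_i; apply: contraNneq la0 => <-.
rewrite mem_sort; apply/negP => /allpairsPdep[j [i [+ + /esym/eqP]]].
rewrite !mem_iota !add0n /= => lt_j lt_i.
by rewrite muln_eq0 !(negPf (pos _ _)) //; apply: ltn_trans lt_j.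
Qed.

Lemma singleton_pre2_partitions (n : nat) :
  0 < n -> pre2_partitions n [:: n].
Proof.
move=> n_gt0; split.
  by rewrite /is_partition_of /is_partition /= !inE; lia.
exists [:: n; 1]; split => //; last by rewrite /pre2 /= muln1.
by rewrite /is_partition /= !inE; lia.
Qed.

(** Since [:: n] is always counted, a count of 1 pins down which partition is
    the only one; this replaces a cardinality by a statement on preimages. *)
Lemma num_pre2_eq1P (n : nat) (n_gt0 : 0 < n) :
  num_pre2 n = 1 <-> forall nu, pre2_partitions n nu -> nu = [:: n].
Proof.
have fin := finite_pre2_partitions n.
have mem nu : (nu \in fset_set (pre2_partitions n)) = `[< pre2_partitions n nu >].
  by rewrite in_fset_set.
split=> [/eqP/cardfs1P[nu0 E] nu | all_n].
  have in_nu0 mu : pre2_partitions n mu -> mu = nu0.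
    by move=> /asboolT; rewrite -mem E inE => /eqP.
  by move=> /in_nu0 ->; rewrite -(in_nu0 _ (singleton_pre2_partitions n_gt0)).
apply/eqP/cardfs1P; exists [:: n]; apply/fsetP => nu; rewrite mem inE.
apply/asboolP/eqP => [|->]; first exact: all_n.
exact: singleton_pre2_partitions.
Qed.

Lemma exists_long_preimage (n : nat) :
  0 < n -> ~ (n = 1 \/ n = 2 \/ n = 4) ->
  exists la, [/\ is_partition la, 3 <= size la & sumn (pre2 la) = n].
Proof.
move=> n_gt0 nP.
have [n_odd | n_even] := boolP (odd n).
  exists [:: n./2; 1; 1]; split=> //; last by rewrite sumn_pre2 /=; lia.
  by rewrite /is_partition /= !inE; lia.
have [n4 | n4] := boolP (4 %| n).
  (* For n = 8 the family member is (1, 2, 2), which has to be reordered. *)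
  have [-> | n8] := eqVneq n 8.
    by exists [:: 2; 2; 1]; split; rewrite // sumn_pre2.
  exists [:: n %/ 4 - 1; 2; 2]; split=> //; last by rewrite sumn_pre2 /=; lia.
  by rewrite /is_partition /= !inE; lia.
have [-> | n6] := eqVneq n 6.
  by exists [:: 1; 1; 1; 1]; split; rewrite // sumn_pre2.
exists [:: (n - 6) %/ 4; 1; 1; 1; 1]; split=> //.
  by rewrite /is_partition /= !inE; lia.
by rewrite sumn_pre2 /=; lia.
Qed.

(** A partition of n has at most n parts, so for these n at most 4 products are
    available, which bounds the length of the preimage by 3. *)
Lemma pre2_partitions_singleton (n : nat) (nu : seq nat) :
  n = 1 \/ n = 2 \/ n = 4 -> pre2_partitions n nu -> nu = [:: n].
Proof.
move=> nP [/andP[/andP[_ nu0] /eqP sum_nu] [la [la_part la_size nuE]]].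
have size_nu : 'C(size la, 2) <= 4.
  by rewrite -size_pre2 -nuE (leq_trans (size_partition nu0)) // sum_nu; lia.
have la_le3 : size la <= 3.
  rewrite leqNgt; apply/negP => /(leq_bin2l 2) le6.
  by have := leq_trans le6 size_nu.
have pre_sum : sumn (pre2 la) = n by rewrite -nuE.
case: la la_part la_size nuE {size_nu} la_le3 pre_sum
  => [|a [|b [|c [|d la]]]] //.
  by move=> _ _ -> _ <-; rewrite /pre2 /= addn0.
rewrite sumn_pre2 /is_partition /= !inE => abc _ _ _ sum_abc.
have [c_gt0 le_cb le_ba] : [/\ 0 < c, c <= b & b <= a] by split; lia.
have [b1 | b_gt1] := leqP b 1.
  by have [eb ec] : b = 1 /\ c = 1 by [lia]; subst; lia.
have ab : 2 * 2 <= a * b by apply: leq_mul; lia.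
have ac : 2 * 1 <= a * c by apply: leq_mul; lia.
by lia.
Qed.

Theorem theorem3p17 (n : nat) (n_gt0 : 0 < n) :
  num_pre2 n = 1 <-> n = 1 \/ n = 2 \/ n = 4.
Proof.
rewrite num_pre2_eq1P //; split=> [all_n | nP nu]; last first.
  exact: pre2_partitions_singleton.
apply: contrapT => /(exists_long_preimage n_gt0)[la [la_part la3 la_sum]].
have : pre2_partitions n (pre2 la).
  split; first by rewrite /is_partition_of is_partition_pre2 // la_sum /=.
  by exists la; split=> //; apply: ltnW.
move=> /all_n/(congr1 size); rewrite size_pre2 => size1.
by have := leq_bin2l 2 la3; rewrite size1.
Qed.
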